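(* Let $G$ be an arbitrary group and let $H=\bigoplus_{g\in G}H_g$ be a faithfully $G$-graded quasi-Hopf algebra over a field $\Bbbk$. The assignments \[ I\longmapsto I\cap H_e \qquad\text{and}\qquad J\longmapsto J^G:=\sum_{g\in G}H_gJ \] define a bijective correspondence between the set of $G$-graded quasi-Hopf ideals of $H$ and the set of $G$-invariant quasi-Hopf ideals $J\subseteq H_e$ of $H_e$.
   Context: Conventions. $\Bbbk$ is a field; vector spaces, algebras and tensor products are over $\Bbbk$; algebras are unital and algebra (anti-)morphisms preserve units. For subspaces $U,V$ of an algebra, $UV$ is the linear span of the products $uv$. Summation is suppressed: $\Delta(x)=x'\otimes x''$, $\Phi=\Phi^{(1)}\otimes\Phi^{(2)}\otimes\Phi^{(3)}$, $\Phi^{-1}=\Phi^{(-1)}\otimes\Phi^{(-2)}\otimes\Phi^{(-3)}$. Quasi-Hopf algebras. A quasi-Hopf algebra is an algebra $H$ with algebra morphisms $\Delta\colon H\to H\otimes H$, $\varepsilon\colon H\to\Bbbk$, an invertible $\Phi\in H^{\otimes 3}$, an algebra anti-morphism $S\colon H\to H$ (not assumed bijective) and elements $\alpha,\beta\in H$ such that for all $x\in H$: $(1\otimes\Phi)(\mathrm{id}\otimes\Delta\otimes\mathrm{id})(\Phi)(\Phi\otimes1)=(\mathrm{id}\otimes\mathrm{id}\otimes\Delta)(\Phi)(\Delta\otimes\mathrm{id}\otimes\mathrm{id})(\Phi)$; $\Phi(\Delta\otimes\mathrm{id})(\Delta(x))=(\mathrm{id}\otimes\Delta)(\Delta(x))\Phi$;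 $(\mathrm{id}\otimes\varepsilon\otimes\mathrm{id})(\Phi)=1\otimes1$; $(\mathrm{id}\otimes\varepsilon)\Delta(x)=x=(\varepsilon\otimes\mathrm{id})\Delta(x)$; $S(x')\alpha x''=\varepsilon(x)\alpha$; $x'\beta S(x'')=\varepsilon(x)\beta$; $\Phi^{(1)}\beta S(\Phi^{(2)})\alpha\Phi^{(3)}=1=S(\Phi^{(-1)})\alpha\Phi^{(-2)}\beta S(\Phi^{(-3)})$. Throughout, $(\alpha,\beta)$ is normalized by $\varepsilon(\alpha)=\varepsilon(\beta)=1$. A quasi-Hopf ideal of $H$ is a two-sided ideal $I$ with $\Delta(I)\subseteq I\otimes H+H\otimes I$, $\varepsilon(I)=0$, $S(I)\subseteq I$. Gradings. For a group $G$ with identity $e$, a $G$-graded quasi-Hopf algebra is a quasi-Hopf algebra with a vector space decomposition $H=\bigoplus_{g\in G}H_g$ such that $H_gH_h\subseteq H_{gh}$, $\Delta(H_g)\subseteq H_g\otimes H_g$, $S(H_g)\subseteq H_{g^{-1}}$, $\Phi\in H_e^{\otimes3}$, $\alpha,\beta\in H_e$; then $H_e$ is a quasi-Hopf algebra with the restricted structure. It is faithfully graded if $H_g\neq0$ for all $g$. An ideal $I$ of $H$ is $G$-graded if $I=\bigoplus_{g\in G}(I\cap H_g)$. An ideal $J$ of $H_e$ is $G$-invariant if $H_gJ=JH_g$ for all $g\in G$. *)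

(* Defs.v *)
From HB Require Import structures.
From mathcomp Require Import all_boot all_order all_algebra sesquilinear.
From mathcomp Require Import boolp classical_sets functions.

Set Implicit Arguments.
Unset Strict Implicit.
Unset Printing Implicit Defensive.

Import GRing.Theory.

Local Open Scope ring_scope.
Local Open Scope classical_set_scope.

Section Subspaces.
Variables (k : fieldType) (V : lmodType k).

Definition subspace (U : set V) : Prop :=
  U 0 /\ forall a u v, U u -> U v -> U (a *: u + v).

Definition lspan (A : set V) : set V := smallest subspace A.

Definition addS (U W : set V) : set V := [set u + w | u in U & w in W].

Definition sumS (I : Type) (F : I -> set V) : set V :=
  lspan (\bigcup_(i in setT) F i).

Definition independent (I : eqType) (F : I -> set V) : Prop :=
  forall (s : seq I) (x : I -> V), uniq s -> (forall i, i \in s -> F i (x i)) ->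
    \sum_(i <- s) x i = 0 -> forall i, i \in s -> x i = 0.

Definition is_direct_sum (I : eqType) (U : set V) (F : I -> set V) : Prop :=
  [/\ forall i, subspace (F i), U = sumS F & independent F].

End Subspaces.

Definition mulS (k : fieldType) (A : algType k) (U W : set A) : set A :=
  lspan [set u * w | u in U & w in W].

Lemma linear_fun0 (k : fieldType) (U W : lmodType k) (g : U -> W) :
  linear g -> g 0 = 0.
Proof. by move=> /(_ (-1) 0 0); rewrite !scaleN1r !addNr. Qed.

Lemma linear_funD (k : fieldType) (U W : lmodType k) (g : U -> W) :
  linear g -> {morph g : x y / x + y}.
Proof. by move=> gl x y; have := gl 1 x y; rewrite !scale1r. Qed.

Lemma linear_funZ (k : fieldType) (U W : lmodType k) (g : U -> W) :
  linear g -> forall a, {morph g : x / a *: x}.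
Proof.
by move=> gl a x; have := gl a x 0; rewrite (linear_fun0 gl) !addr0.
Qed.

Section TensorDef.
Variables (k : fieldType) (U V : lmodType k).

(* A sequence [:: (u1, v1); ...; (un, vn)] stands for u1 ⊗ v1 + ... + un ⊗ vn. *)
Inductive tens_eq : seq (U * V) -> seq (U * V) -> Prop :=
| tens_eq_refl s : tens_eq s s
| tens_eq_sym s t : tens_eq s t -> tens_eq t s
| tens_eq_trans s t r : tens_eq s t -> tens_eq t r -> tens_eq s r
| tens_eq_cat s s' t t' :
    tens_eq s s' -> tens_eq t t' -> tens_eq (s ++ t) (s' ++ t')
| tens_eq_catC s t : tens_eq (s ++ t) (t ++ s)
| tens_eq_addl u u' v : tens_eq [:: (u + u', v)] [:: (u, v); (u', v)]
| tens_eq_addr u v v' : tens_eq [:: (u, v + v')] [:: (u, v); (u, v')]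
| tens_eq_scale a u v : tens_eq [:: (a *: u, v)] [:: (u, a *: v)]
| tens_eq_0 v : tens_eq [:: (0, v)] [::].

Definition tens_rel (s t : seq (U * V)) : bool := `[< tens_eq s t >].

Lemma tens_rel_refl : reflexive tens_rel.
Proof. by move=> s; apply/asboolP; exact: tens_eq_refl. Qed.

Lemma tens_rel_sym : symmetric tens_rel.
Proof. by move=> s t; apply/asboolP/asboolP; exact: tens_eq_sym. Qed.

Lemma tens_rel_trans : transitive tens_rel.
Proof.
move=> t s r /asboolP st /asboolP tr; apply/asboolP; exact: tens_eq_trans tr.
Qed.

Canonical tens_equiv :=
  EquivRel tens_rel tens_rel_refl tens_rel_sym tens_rel_trans.

Definition tens : Type := {eq_quot tens_equiv}%qT.

HB.instance Definition _ := Choice.copy tens {eq_quot tens_equiv}%qT.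

Definition tens_pi (s : seq (U * V)) : tens := \pi_{eq_quot tens_equiv}%qT s.
Definition tens_repr (x : tens) : seq (U * V) :=
  repr (x : {eq_quot tens_equiv}%qT).

Local Notation pi := tens_pi.
Local Notation rp := tens_repr.

Lemma tens_piP s t : pi s = pi t <-> tens_eq s t.
Proof.
split=> [/eqmodP/asboolP //|h]; apply/eqmodP; exact/asboolP.
Qed.

Lemma tens_piK (x : tens) : pi (rp x) = x. Proof. exact: reprK. Qed.

Lemma tens_reprP s : tens_eq (rp (pi s)) s.
Proof. by apply/tens_piP; rewrite tens_piK. Qed.

Let scale_seq (a : k) (s : seq (U * V)) := [seq (a *: p.1, p.2) | p <- s].

Let tens0 : tens := pi [::].
Let tensD (x y : tens) : tens := pi (rp x ++ rp y).
Let tensZ (a : k) (x : tens) : tens := pi (scale_seq a (rp x)).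

Let tensDE s t : tensD (pi s) (pi t) = pi (s ++ t).
Proof. by apply/tens_piP; apply: tens_eq_cat; exact: tens_reprP. Qed.

Let scale_seq_eq a s t : tens_eq s t -> tens_eq (scale_seq a s) (scale_seq a t).
Proof.
elim=> {s t} [s|s t _|s t r _ st _|s s' t t' _ ss' _ tt'|s t|u u' v|u v v'|b u v|v];
  rewrite /scale_seq ?map_cat /=.
- exact: tens_eq_refl.
- exact: tens_eq_sym.
- exact: tens_eq_trans st.
- exact: tens_eq_cat.
- exact: tens_eq_catC.
- rewrite scalerDr; exact: tens_eq_addl.
- exact: tens_eq_addr.
- by rewrite scalerA mulrC -scalerA; exact: tens_eq_scale.
- rewrite scaler0; exact: tens_eq_0.
Qed.

Let tensZE a s : tensZ a (pi s) = pi (scale_seq a s).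
Proof. by apply/tens_piP/scale_seq_eq/tens_reprP. Qed.

Let tensDA : associative tensD.
Proof.
by move=> x y z; rewrite -[x]tens_piK -[y]tens_piK -[z]tens_piK !tensDE catA.
Qed.

Let tensDC : commutative tensD.
Proof.
move=> x y; rewrite -[x]tens_piK -[y]tens_piK !tensDE.
by apply/tens_piP/tens_eq_catC.
Qed.

Let tens0D : left_id tens0 tensD.
Proof. by move=> x; rewrite -[x]tens_piK tensDE. Qed.

Let tensZDl a b x : tensZ (a + b) x = tensD (tensZ a x) (tensZ b x).
Proof.
rewrite -[x]tens_piK !tensZE tensDE; elim: (rp x) => [//|[u v] s IHs] /=.
have -> : pi (((a + b) *: u, v) :: scale_seq (a + b) s)
    = tensD (pi [:: ((a + b) *: u, v)]) (pi (scale_seq (a + b) s)).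
  by rewrite tensDE.
have -> : pi [:: ((a + b) *: u, v)] = pi [:: (a *: u, v); (b *: u, v)].
  by apply/tens_piP; rewrite scalerDl; exact: tens_eq_addl.
rewrite IHs !tensDE; apply/tens_piP.
have swap (p q : U * V) s1 s2 :
    tens_eq ([:: p] ++ [:: q] ++ s1 ++ s2) ([:: p] ++ s1 ++ [:: q] ++ s2).
  apply: tens_eq_cat; first exact: tens_eq_refl.
  rewrite !catA; apply: tens_eq_cat; last exact: tens_eq_refl.
  exact: tens_eq_catC.
exact: swap.
Qed.

Let tens0Z x : tensZ 0 x = tens0.
Proof.
rewrite -[x]tens_piK tensZE; apply/tens_piP.
elim: (rp x) => [|[u v] s IHs] /=; first exact: tens_eq_refl.
rewrite -cat1s -[X in tens_eq _ X]cat0s; apply: tens_eq_cat => //.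
by rewrite scale0r; exact: tens_eq_0.
Qed.

Let tensZA a b x : tensZ a (tensZ b x) = tensZ (a * b) x.
Proof.
rewrite -[x]tens_piK !tensZE /scale_seq -map_comp; congr (pi _).
by apply: eq_map => -[u v] /=; rewrite scalerA.
Qed.

Let tens1Z : left_id 1 tensZ.
Proof.
move=> x; rewrite -[x]tens_piK tensZE; congr (pi _).
by rewrite -[RHS]map_id; apply: eq_map => -[u v] /=; rewrite scale1r.
Qed.

Let tensZDr : right_distributive tensZ tensD.
Proof.
move=> a x y; rewrite -[x]tens_piK -[y]tens_piK tensDE !tensZE tensDE.
by rewrite /scale_seq map_cat.
Qed.

Let tensND : left_inverse tens0 (tensZ (-1)) tensD.
Proof. by move=> x; rewrite -{2}[x]tens1Z -tensZDl addNr tens0Z. Qed.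

HB.instance Definition _ :=
  GRing.isZmodule.Build tens tensDA tensDC tens0D tensND.

HB.instance Definition _ :=
  GRing.Zmodule_isLmodule.Build k tens tensZA tens1Z tensZDr
    (fun x a b => tensZDl a b x).

Definition tpure (u : U) (v : V) : tens := pi [:: (u, v)].

(* The value of a bilinear map f at a tensor; meaningless if f is not bilinear. *)
Definition tlift (W : lmodType k) (f : U -> V -> W) (x : tens) : W :=
  \sum_(p <- rp x) f p.1 p.2.

Let tlift_pi (W : lmodType k) (f : U -> V -> W) s :
  bilinear_for *:%R *:%R f -> tlift f (pi s) = \sum_(p <- s) f p.1 p.2.
Proof.
move=> [fl fr].
have f0 v : f 0 v = 0 := linear_fun0 (fl v).
have fD u u' v : f (u + u') v = f u v + f u' v := linear_funD (fl v) u u'.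
have fDr u v v' : f u (v + v') = f u v + f u v' := linear_funD (fr u) v v'.
have fZ a u v : f (a *: u) v = a *: f u v := linear_funZ (fl v) a u.
have fZr a u v : f u (a *: v) = a *: f u v := linear_funZ (fr u) a v.
suff H s1 s2 : tens_eq s1 s2 ->
    \sum_(p <- s1) f p.1 p.2 = \sum_(p <- s2) f p.1 p.2.
  by apply/H/tens_reprP.
elim=> {s1 s2} // [s1 s2 s3 _ -> _ ->//|s1 s2 t1 t2 _ E1 _ E2|s1 s2|u u' v|
  u v v'|a u v|v].
- by rewrite !big_cat /= E1 E2.
- by rewrite !big_cat /= addrC.
- by rewrite !big_cons !big_nil !addr0 /= fD.
- by rewrite !big_cons !big_nil !addr0 /= fDr.
- by rewrite !big_seq1 /= fZ fZr.
- by rewrite big_seq1 big_nil /= f0.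
Qed.

Lemma tliftE (W : lmodType k) (f : U -> V -> W) u v :
  bilinear_for *:%R *:%R f -> tlift f (tpure u v) = f u v.
Proof. by move=> fb; rewrite /tpure tlift_pi // big_seq1. Qed.

Lemma tlift_linear (W : lmodType k) (f : U -> V -> W) :
  bilinear_for *:%R *:%R f -> linear (tlift f).
Proof.
move=> fb a x y; rewrite -[x]tens_piK -[y]tens_piK.
rewrite -[a *: _]/(tensZ a _) -[_ + pi _]/(tensD _ _) tensZE tensDE.
rewrite !tlift_pi // big_cat /= /scale_seq big_map scaler_sumr; congr (_ + _).
have [fl _] := fb; apply: eq_bigr => -[u v] _ /=.
by rewrite (linear_funZ (fl v)).
Qed.

Lemma tens_sum_pure (x : tens) :
  exists s : seq (U * V), x = \sum_(p <- s) tpure p.1 p.2.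
Proof.
exists (rp x); rewrite -[LHS]tens_piK; elim: (rp x) => [|[u v] s IHs].
  by rewrite big_nil.
by rewrite big_cons -IHs -[RHS]/(tensD _ _) tensDE.
Qed.

Lemma tpure_bilinear : bilinear_for *:%R *:%R tpure.
Proof.
split=> [v a u u'|u a v v'] /=.
- rewrite -[RHS]/(tensD (tensZ a _) _) tensZE tensDE /=.
  by apply/tens_piP; exact: tens_eq_addl.
- rewrite -[RHS]/(tensD (tensZ a _) _) tensZE tensDE /=; apply/tens_piP.
  apply: tens_eq_trans (tens_eq_addr _ _ _) _; rewrite -cat1s -[X in tens_eq _ X]cat1s.
  apply: tens_eq_cat; last exact: tens_eq_refl.
  by apply: tens_eq_sym; exact: tens_eq_scale.
Qed.

Lemma tens_ext (W : lmodType k) (f g : tens -> W) : linear f -> linear g ->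
  (forall u v, f (tpure u v) = g (tpure u v)) -> f =1 g.
Proof.
move=> fl gl fg x; have [s ->] := tens_sum_pure x.
elim: s => [|p s IHs]; first by rewrite big_nil !linear_fun0.
by rewrite big_cons !linear_funD // IHs fg.
Qed.

End TensorDef.

Notation "u ⊗ v" := (tpure u v) (at level 40, left associativity) : ring_scope.

Section TensorMaps.
Variable k : fieldType.
Implicit Types U V W : lmodType k.

Definition tmap U V U' V' (f : U -> U') (g : V -> V') : tens U V -> tens U' V' :=
  tlift (fun u v => f u ⊗ g v).

Definition tassoc U V W : tens (tens U V) W -> tens U (tens V W) :=
  tlift (fun t w => tlift (fun u v => u ⊗ (v ⊗ w)) t).

Definition tensS U V (A : set U) (B : set V) : set (tens U V) :=
  lspan [set a ⊗ b | a in A & b in B].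

End TensorMaps.
Lemma tlift_param (k : fieldType) (X U V W : lmodType k)
    (F : X -> U -> V -> W) (t : tens U V) :
  (forall u v, linear (fun x => F x u v)) -> linear (fun x => tlift (F x) t).
Proof.
move=> Fl a x y; rewrite /tlift scaler_sumr -big_split /=.
by apply: eq_bigr => p _; exact: Fl.
Qed.

(* A linear form taking the value 1 at a given nonzero vector, from a maximal
   subspace avoiding that vector. *)
Lemma exists_linear_form (k : fieldType) (V : lmodType k) (e : V) :
  e != 0 -> exists f : V -> k^o, linear f /\ f e = 1.
Proof.
move=> e0.
pose P (M : set V) := (forall a u v, M u -> M v -> M (a *: u + v)) /\ ~ M e.
have [F FP Ft|M [[Ml Me] Mmax]] := @Zorn_bigcup V P.
  split=> [a u v [X FX Xu] [Y FY Yv]|[X FX]]; last by have [] := FP _ FX.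
  have [XY|YX] := Ft _ _ FX FY.
    by exists Y => //; apply: (FP _ FY).1 => //; exact: XY.
  by exists X => //; apply: (FP _ FX).1 => //; exact: YX.
have M0 : M 0.
  apply: contrapT => nM0.
  have MM : forall x, ~ M x.
    move=> x Mx; apply: nM0.
    by have := Ml (-1) x x Mx Mx; rewrite scaleN1r addNr.
  apply: (Mmax [set 0]).
    by split=> [x /MM //|/(_ 0 erefl)/MM].
  split=> [a u v -> ->|]; first by rewrite scaler0 addr0.
  by move/eqP; rewrite (negPf e0).
have MZ a u : M u -> M (a *: u) by move=> Mu; rewrite -[_ *: _]addr0; exact: Ml.
have MD u v : M u -> M v -> M (u + v).
  by move=> Mu Mv; have := Ml 1 u v Mu Mv; rewrite scale1r.
have ex x : exists c : k, M (x - c *: e).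
  have [Mx|nMx] := pselect (M x); first by exists 0; rewrite scale0r subr0.
  pose N := [set u | exists c : k, M (u + c *: x)].
  have NN : ~ P N.
    apply: Mmax; split=> [u Mu|/(_ x)].
      by exists 0; rewrite scale0r addr0.
    by move=> h; apply/nMx/h; exists (-1); rewrite scaleN1r subrr.
  have [c Mc] : N e.
    apply: contrapT => nNe; apply: NN; split=> // a u v [c Mu] [d Mv].
    exists (a * c + d); have := Ml a _ _ Mu Mv.
    by rewrite scalerDr scalerA scalerDl addrACA.
  have c0 : c != 0.
    by apply/eqP => c0; apply: Me; move: Mc; rewrite c0 scale0r addr0.
  exists (- c^-1); rewrite scaleNr opprK addrC.
  have := MZ c^-1 _ Mc.
  by rewrite scalerDr scalerA mulVf // scale1r.
have uniq_ c d : M ((c - d) *: e) -> c = d.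
  move=> h; apply/eqP; rewrite -subr_eq0; apply/eqP.
  apply: contrapT => /eqP cd; apply: Me.
  by have := MZ (c - d)^-1 _ h; rewrite scalerA mulVf // scale1r.
pose f x : k^o := projT1 (cid (ex x)).
have fP x : M (x - f x *: e) by rewrite /f; case: cid.
exists f; split.
  move=> a x y; apply: uniq_.
  have := Ml (-1) _ _ (fP (a *: x + y)) (Ml a _ _ (fP x) (fP y)).
  rewrite scaleN1r opprB scalerBr scalerA [a *: x - _ + _]addrACA -opprD.
  by rewrite addrA addrNK -scalerDl -scalerBl.
apply: uniq_; rewrite scalerBl scale1r -opprB -scaleN1r.
exact/MZ/fP.
Qed.

Lemma tpure_neq0 (k : fieldType) (U V : lmodType k) (u : U) (v : V) :
  u != 0 -> v != 0 -> u ⊗ v != 0.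
Proof.
move=> u0 v0; have [f [fl fu]] := exists_linear_form u0.
have [g [gl gv]] := exists_linear_form v0.
pose F (x : U) (y : V) : k^o := f x * g y.
have Fb : bilinear_for *:%R *:%R F.
  split=> [y a x x'|x a y y'] /=; rewrite /F.
    by rewrite fl mulrDl -mulrA.
  by rewrite gl mulrDr [in LHS]mulrCA.
apply: contra_neq (oner_neq0 k) => uv0.
have := tliftE u v Fb; rewrite uv0 (linear_fun0 (tlift_linear Fb)) /F fu gv.
by rewrite mulr1.
Qed.

Section TensorAlgebra.
Variables (k : fieldType) (A B : algType k).
Local Notation T := (tens A B).

Definition tmul (x y : T) : T :=
  tlift (fun a b => tlift (fun a' b' => (a * a') ⊗ (b * b')) y) x.

Let pl b : linear (fun a : A => a ⊗ b : T) := (tpure_bilinear A B).1 b.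
Let pr a : linear (fun b : B => a ⊗ b : T) := (tpure_bilinear A B).2 a.

Let mul_in (a : A) (b : B) :
  bilinear_for *:%R *:%R (fun a' b' => (a * a') ⊗ (b * b') : T).
Proof.
by split=> [b' c x y|a' c x y] /=; rewrite mulrDr -scalerAr ?pl ?pr.
Qed.

Let mul_out (y : T) : bilinear_for *:%R *:%R
  (fun a b => tlift (fun a' b' => (a * a') ⊗ (b * b') : T) y).
Proof.
split=> [b|a]; apply: tlift_param => a' b' c x z /=.
  by rewrite mulrDl -scalerAl pl.
by rewrite mulrDl -scalerAl pr.
Qed.

Lemma tmul_pure a b a' b' : tmul (a ⊗ b) (a' ⊗ b') = (a * a') ⊗ (b * b').
Proof. by rewrite /tmul (tliftE _ _ (mul_out _)) (tliftE _ _ (mul_in _ _)). Qed.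

Lemma tmul_linearl y : linear (tmul^~ y).
Proof. exact: (tlift_linear (mul_out y)). Qed.

Lemma tmul_linearr x : linear (tmul x).
Proof.
move=> c y z; rewrite /tmul /tlift -/(tlift _ _) scaler_sumr -big_split /=.
apply: eq_bigr => p _; exact: (tlift_linear (mul_in _ _)).
Qed.

Let lcomp (U V W : lmodType k) (f : V -> W) (g : U -> V) :
  linear f -> linear g -> linear (f \o g).
Proof. by move=> fl gl a x y /=; rewrite gl fl. Qed.

Lemma tmulA : associative tmul.
Proof.
move=> x y z; move: x; apply: tens_ext.
- exact: tmul_linearl.
- exact: (lcomp (tmul_linearl z) (tmul_linearl y)).
move=> a b; move: y; apply: tens_ext.
- exact: (lcomp (tmul_linearr _) (tmul_linearl z)).
- exact: (lcomp (tmul_linearl z) (tmul_linearr _)).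
move=> a' b'; move: z; apply: tens_ext.
- exact: (lcomp (tmul_linearr _) (tmul_linearr _)).
- exact: tmul_linearr.
by move=> a'' b''; rewrite !tmul_pure !mulrA.
Qed.

Lemma tmul1l : left_id (1 ⊗ 1) tmul.
Proof.
apply: tens_ext; [exact: tmul_linearr|by []|].
by move=> a b; rewrite tmul_pure !mul1r.
Qed.

Lemma tmul1r : right_id (1 ⊗ 1) tmul.
Proof.
apply: tens_ext; [exact: tmul_linearl|by []|].
by move=> a b; rewrite tmul_pure !mulr1.
Qed.

Lemma tmulDl : left_distributive tmul +%R.
Proof. by move=> x y z; exact: (linear_funD (tmul_linearl z)). Qed.

Lemma tmulDr : right_distributive tmul +%R.
Proof. by move=> x y z; exact: (linear_funD (tmul_linearr x)). Qed.

Lemma tens1_neq0 : (1 ⊗ 1 : T) != 0.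
Proof. by apply: tpure_neq0; exact: oner_neq0. Qed.

HB.instance Definition _ := GRing.Zmodule_isNzRing.Build T
  tmulA tmul1l tmul1r tmulDl tmulDr tens1_neq0.

Lemma tens_scaleAl (c : k) (x y : T) : c *: (x * y) = c *: x * y.
Proof. exact/esym/(linear_funZ (tmul_linearl y)). Qed.

HB.instance Definition _ := GRing.Lmodule_isLalgebra.Build k T tens_scaleAl.

Lemma tens_scaleAr (c : k) (x y : T) : c *: (x * y) = x * (c *: y).
Proof. exact/esym/(linear_funZ (tmul_linearr x)). Qed.

HB.instance Definition _ := GRing.Lalgebra_isAlgebra.Build k T tens_scaleAr.

Lemma tens_mul_pure (a a' : A) (b b' : B) :
  (a ⊗ b) * (a' ⊗ b') = (a * a') ⊗ (b * b') :> T.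
Proof. exact: tmul_pure. Qed.

End TensorAlgebra.

Section QuasiHopf.
Variables (k : fieldType) (H : algType k).

Local Notation H2 := (tens H H).
Local Notation H3 := (tens H H2).

Record quasi_hopf := QuasiHopf {
  qh_comul : {lrmorphism H -> H2};
  qh_counit : {lrmorphism H -> k^o};
  qh_Phi : H3;
  qh_Phi_inv : H3;
  qh_antipode : {linear H -> H};
  qh_alpha : H;
  qh_beta : H;
  qh_PhiK : qh_Phi * qh_Phi_inv = 1;
  qh_PhiVK : qh_Phi_inv * qh_Phi = 1;
  qh_antipode1 : qh_antipode 1 = 1;
  qh_antipodeM : forall x y, qh_antipode (x * y) = qh_antipode y * qh_antipode x;
  (* all factors are rebracketed into H ⊗ (H ⊗ (H ⊗ H)) *)
  qh_pentagon : (1 ⊗ qh_Phi)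
      * tmap id (@tassoc k H H H) (tmap id (tmap qh_comul id) qh_Phi)
      * tmap id (@tassoc k H H H) (tassoc (qh_Phi ⊗ (1 : H)))
    = tmap id (tmap id qh_comul) qh_Phi * tassoc (tmap qh_comul id qh_Phi);
  qh_coassoc : forall x,
      qh_Phi * tassoc (tmap qh_comul id (qh_comul x))
    = tmap id qh_comul (qh_comul x) * qh_Phi;
  qh_Phi_counit : tmap id (tlift (fun y z => qh_counit y *: z)) qh_Phi = 1 ⊗ 1 :> H2;
  qh_counitr : forall x, tlift (fun y z => qh_counit z *: y) (qh_comul x) = x;
  qh_counitl : forall x, tlift (fun y z => qh_counit y *: z) (qh_comul x) = x;
  qh_alphaP : forall x,
      tlift (fun y z => qh_antipode y * qh_alpha * z) (qh_comul x)
    = qh_counit x *: qh_alpha;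
  qh_betaP : forall x,
      tlift (fun y z => y * qh_beta * qh_antipode z) (qh_comul x)
    = qh_counit x *: qh_beta;
  qh_zigzag : tlift (fun x => tlift (fun y z =>
        x * qh_beta * qh_antipode y * qh_alpha * z)) qh_Phi = 1;
  qh_zigzag_inv : tlift (fun x => tlift (fun y z =>
        qh_antipode x * qh_alpha * y * qh_beta * qh_antipode z)) qh_Phi_inv = 1;
  qh_counit_alpha : qh_counit qh_alpha = 1;
  qh_counit_beta : qh_counit qh_beta = 1
}.

Variable Q : quasi_hopf.

(* J is a quasi-Hopf ideal of K, where K is a subspace of H that is a quasi-Hopf
   algebra for the structure restricted from H (K = H included).  As k is a
   field, K ⊗ K is identified with its image tensS K K in H ⊗ H. *)
Definition quasi_hopf_ideal (K J : set H) : Prop :=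
  [/\ J `<=` K /\ subspace J,
      forall a x, K a -> J x -> J (a * x) /\ J (x * a),
      forall x, J x -> addS (tensS J K) (tensS K J) (qh_comul Q x),
      forall x, J x -> qh_counit Q x = 0 &
      forall x, J x -> J (qh_antipode Q x)].

Variable G : groupType.
Implicit Type gr : G -> set H.

Definition graded_quasi_hopf gr : Prop :=
  [/\ is_direct_sum [set: H] gr,
      forall g h, mulS (gr g) (gr h) `<=` gr (g * h)%g,
      forall g x, gr g x -> tensS (gr g) (gr g) (qh_comul Q x),
      forall g x, gr g x -> gr g^-1%g (qh_antipode Q x) &
      [/\ tensS (gr 1%g) (tensS (gr 1%g) (gr 1%g)) (qh_Phi Q),
          gr 1%g (qh_alpha Q) & gr 1%g (qh_beta Q)]].

Definition faithful_grading gr : Prop := forall g, gr g <> [set 0].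

Definition graded_quasi_hopf_ideal gr (I : set H) : Prop :=
  quasi_hopf_ideal [set: H] I /\ is_direct_sum I (fun g => I `&` gr g).

Definition invariant_quasi_hopf_ideal gr (J : set H) : Prop :=
  quasi_hopf_ideal (gr 1%g) J /\ forall g, mulS (gr g) J = mulS J (gr g).

End QuasiHopf.

(* Main.v *)
(* The grading is strong: the counit is nonzero on each H_g, since it recovers
   an element x of H_g from its coproduct in H_g ⊗ H_g; hence the antipode axiom
   S(x')αx'' = ε(x)α puts α in the ideal H_{g⁻¹}H_g of H_e, and the zigzag
   identity, whose factors lie in H_e, then puts 1 in it.  Writing 1 as a sum of
   products in H_gH_{g⁻¹} or H_{g⁻¹}H_g gives H_g(I ∩ H_e) = I ∩ H_g =
   (I ∩ H_e)H_g for every two-sided ideal I.  Conversely, directness of the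
   grading gives J^G ∩ H_e = H_eJ = J.  Projecting both tensor factors onto H_e
   carries Δ(I ∩ H_e) ⊆ I ⊗ H + H ⊗ I into the same inclusion over H_e. *)
Require Import Defs.
From mathcomp Require Import all_boot all_order all_algebra.
From mathcomp Require Import sesquilinear.
From mathcomp Require Import boolp classical_sets functions.

Set Implicit Arguments.
Unset Strict Implicit.
Unset Printing Implicit Defensive.

Import GRing.Theory.

Local Open Scope ring_scope.
Local Open Scope classical_set_scope.

(** * Closure properties of subspaces and linear spans *)

Section Subspaces.
Variables (k : fieldType) (V W : lmodType k).
Implicit Types (A B U : set V).

Lemma subspace0 U : subspace U -> U 0. Proof. by case. Qed.

Lemma subspaceZ U a x : subspace U -> U x -> U (a *: x).
Proof. by move=> [U0 h] xU; rewrite -[_ *: _]addr0; exact: h. Qed.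

Lemma subspaceI A B : subspace A -> subspace B -> subspace (A `&` B).
Proof.
by move=> [A0 AD] [B0 BD]; split=> // a u v [? ?] [? ?]; split; auto.
Qed.

Lemma subspace_set0 : subspace [set 0 : V].
Proof. by split=> // a u v -> ->; rewrite scaler0 addr0. Qed.

Lemma subspace_preimage (f : V -> W) (P : set W) :
  linear f -> subspace P -> subspace (f @^-1` P).
Proof.
move=> fl [P0 PD]; split=> [|a u v fu fv] /=.
  by rewrite (linear_fun0 fl).
by rewrite fl; exact: PD.
Qed.

Lemma subspace_addS A B : subspace A -> subspace B -> subspace (addS A B).
Proof.
move=> [A0 AD] [B0 BD]; split.
  by exists 0 => //; exists 0 => //; rewrite addr0.
move=> a _ _ [u uA [v vB <-]] [u' uA' [v' vB' <-]].
exists (a *: u + u'); first exact: AD.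
by exists (a *: v + v'); [exact: BD|rewrite scalerDr addrACA].
Qed.

Lemma lspan_subspace A : subspace (lspan A).
Proof.
split=> [P [[]]//|a u v uA vA P PA].
by apply: (PA.1).2; [exact: uA|exact: vA].
Qed.

Lemma sub_lspan A : A `<=` lspan A.
Proof. by move=> x xA P [_]; apply. Qed.

Lemma lspan_sub A U : subspace U -> A `<=` U -> lspan A `<=` U.
Proof. by move=> Us AU x; apply. Qed.

End Subspaces.
#[local] Hint Extern 0 (subspace _) => exact: lspan_subspace : core.

(** * Components and projections of a direct sum over an arbitrary index set *)

Section DirectSums.
Variables (k : fieldType) (V : lmodType k) (I : eqType).
Implicit Types (F : I -> set V) (U : set V).

Lemma sub_sumS F i : F i `<=` sumS F.
Proof. by move=> x xF; apply: sub_lspan; exists i. Qed.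

Lemma sumS_sub F U : subspace U -> (forall i, F i `<=` U) -> sumS F `<=` U.
Proof. by move=> Us FU; apply: lspan_sub => // x [i _]; exact: FU. Qed.

(** The components form a total function with finite support, and the list bounding the support is
    existential. Two decompositions can thus be compared pointwise, and a projection is evaluation
    of [f] at an index. *)
Definition decomposes F (x : V) (f : I -> V) : Prop :=
  (forall i, F i (f i)) /\
  exists s, [/\ uniq s, forall i, i \notin s -> f i = 0 &
                x = \sum_(i <- s) f i].

(** The extra terms vanish. This moves two sums with different supports onto the union of the
    supports, where they can be added. *)
Lemma sum_support (f : I -> V) (s t : seq I) : uniq s -> uniq t ->
  {subset s <= t} -> (forall i, i \notin s -> f i = 0) ->
  \sum_(i <- s) f i = \sum_(i <- t) f i.
Proof.
move=> us ut st f0; rewrite [RHS](bigID (mem s)) /= [X in _ + X]big1 ?addr0.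
  rewrite -[RHS]big_filter; apply: perm_big; apply: uniq_perm => //.
    exact: filter_uniq.
  by move=> i; rewrite mem_filter; case: (boolP (i \in s)) => // /st ->.
by move=> i; exact: f0.
Qed.

Lemma decomposes_linear F a x y f g : (forall i, subspace (F i)) ->
  decomposes F x f -> decomposes F y g ->
  decomposes F (a *: x + y) (fun i => a *: f i + g i).
Proof.
move=> Fs [fF [s [us f0 ->]]] [gF [t [ut g0 ->]]]; split.
  by move=> i; apply: (Fs i).2.
exists (undup (s ++ t)); split; first exact: undup_uniq.
  move=> i; rewrite mem_undup mem_cat negb_or => /andP[/f0 -> /g0 ->].
  by rewrite scaler0 addr0.
rewrite (sum_support us (undup_uniq (s ++ t)) _ f0); last first.
  by move=> i; rewrite mem_undup mem_cat => ->.
rewrite (sum_support ut (undup_uniq (s ++ t)) _ g0); last first.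
  by move=> i; rewrite mem_undup mem_cat orbC => ->.
by rewrite scaler_sumr -big_split.
Qed.

Lemma decomposes_component F i x : (forall j, subspace (F j)) -> F i x ->
  decomposes F x (fun j => if j == i then x else 0).
Proof.
move=> Fs xF; split.
  by move=> j; case: eqP => [->//|_]; exact: subspace0.
exists [:: i]; split=> // [j|]; first by rewrite inE => /negPf ->.
by rewrite big_seq1 eqxx.
Qed.

Lemma sumS_decomposes F x : (forall i, subspace (F i)) -> sumS F x ->
  exists f, decomposes F x f.
Proof.
move=> Fs; move: x; apply: sumS_sub.
  split=> [|a x y [f xf] [g yg]].
    by exists (fun=> 0); split=> [i|]; [exact: subspace0|exists [::];
      split; rewrite ?big_nil].
  by exists (fun i => a *: f i + g i); exact: decomposes_linear.
by move=> i x xF; eexists; exact: decomposes_component xF.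
Qed.

(** The combination of the two decompositions with scalar -1 on the first decomposes 0, so
    independence kills each of its components. *)
Lemma decomposes_uniq F x f g : (forall i, subspace (F i)) ->
  independent F -> decomposes F x f -> decomposes F x g -> f =1 g.
Proof.
move=> Fs Fi xf xg i.
have [hF [s [us h0 hs]]] := decomposes_linear (-1) Fs xf xg.
have h j : -1 *: f j + g j = 0.
  have [js|/h0//] := boolP (j \in s).
  apply: (Fi s (fun i => -1 *: f i + g i) us) => //.
  by rewrite -hs scaleN1r addNr.
by apply/eqP; rewrite -subr_eq0 -oppr_eq0 opprB addrC -scaleN1r h.
Qed.

(** A decomposition of every vector is chosen, and the projection reads off its component at [i].
    Linearity and both values come from uniqueness of decompositions. *)
Lemma direct_sum_proj F i : is_direct_sum [set: V] F ->
  exists p : V -> V,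
    [/\ linear p, forall x, F i x -> p x = x
      & forall j x, j != i -> F j x -> p x = 0].
Proof.
move=> [Fs FT Fi].
have ex x : exists f, decomposes F x f by apply: (sumS_decomposes Fs); rewrite -FT.
have [c cP] := choice ex.
exists (c^~ i); split.
- move=> a x y.
  exact: (decomposes_uniq Fs Fi (cP _) (decomposes_linear a Fs (cP x) (cP y))).
- move=> x xF.
  by rewrite (decomposes_uniq Fs Fi (cP x) (decomposes_component Fs xF)) eqxx.
- move=> j x ji xF.
  rewrite (decomposes_uniq Fs Fi (cP x) (decomposes_component Fs xF)).
  by rewrite eq_sym (negPf ji).
Qed.

Lemma independent_sub F F' : (forall i, F' i `<=` F i) ->
  independent F -> independent F'.
Proof. by move=> F'F Fi s x us xF; apply: Fi => // i /xF/F'F. Qed.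

End DirectSums.

(** * Products of subspaces of an algebra *)

Section Products.
Variables (k : fieldType) (A : algType k).
Implicit Types (U W P : set A).

Lemma mulr_linearl (a : A) : linear ( *%R a).
Proof. by move=> c x y; rewrite mulrDr scalerAr. Qed.

Lemma mulr_linearr (a : A) : linear (fun x : A => x * a).
Proof. by move=> c x y; rewrite mulrDl scalerAl. Qed.

Lemma mem_mulS U W u w : U u -> W w -> mulS U W (u * w).
Proof. by move=> uU wW; apply: sub_lspan; exists u => //; exists w. Qed.

Lemma mulS_sub U W P : subspace P -> (forall u w, U u -> W w -> P (u * w)) ->
  mulS U W `<=` P.
Proof. by move=> Ps h; apply: lspan_sub => // _ [u ? [w ? <-]]; exact: h. Qed.

(** By associativity a(uw) = (au)w, so only the effect of [a] on the left factors matters. *)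
Lemma mulS_subl U W P a : (forall u, U u -> P (a * u)) ->
  forall x, mulS U W x -> mulS P W (a * x).
Proof.
move=> h; apply: (@mulS_sub _ _ ( *%R a @^-1` mulS P W)).
  exact/subspace_preimage/lspan_subspace/mulr_linearl.
by move=> u w uU wW /=; rewrite mulrA; apply: mem_mulS => //; exact: h.
Qed.

Lemma mulS_subr U W P a : (forall w, W w -> P (w * a)) ->
  forall x, mulS U W x -> mulS U P (x * a).
Proof.
move=> h; apply: (@mulS_sub _ _ ((fun x => x * a) @^-1` mulS U P)).
  exact/subspace_preimage/lspan_subspace/mulr_linearr.
by move=> u w uU wW /=; rewrite -mulrA; apply: mem_mulS => //; exact: h.
Qed.

End Products.

(** * Tensor products of subspaces and their images under linear maps *)

Section Tensors.
Variables (k : fieldType).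

Lemma mem_tensS (U V : lmodType k) (A : set U) (B : set V) a b :
  A a -> B b -> tensS A B (a ⊗ b).
Proof. by move=> aA bB; apply: sub_lspan; exists a => //; exists b. Qed.

Lemma tensS_sub (U V : lmodType k) (A : set U) (B : set V) P : subspace P ->
  (forall a b, A a -> B b -> P (a ⊗ b)) -> tensS A B `<=` P.
Proof. by move=> Ps h; apply: lspan_sub => // _ [a ? [b ? <-]]; exact: h. Qed.

Lemma tensSS (U V : lmodType k) (A A' : set U) (B B' : set V) :
  A `<=` A' -> B `<=` B' -> tensS A B `<=` tensS A' B'.
Proof.
move=> AA' BB'; apply: tensS_sub => // a b aA bB.
by apply: mem_tensS; [exact: AA'|exact: BB'].
Qed.

Lemma tlift_tensS (U V W : lmodType k) (f : U -> V -> W) A B P :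
  bilinear_for *:%R *:%R f -> subspace P ->
  (forall a b, A a -> B b -> P (f a b)) ->
  forall t, tensS A B t -> P (tlift f t).
Proof.
move=> fb Ps h; apply: (@tensS_sub _ _ _ _ (tlift f @^-1` P)).
  exact/subspace_preimage/Ps/tlift_linear.
by move=> a b aA bB /=; rewrite tliftE //; exact: h.
Qed.

Lemma tensM_tensS (A B : algType k) (U U' : set A) (W W' : set B)
    (s t : tens A B) : tensS U W s -> tensS U' W' t ->
  tensS (mulS U U') (mulS W W') (s * t).
Proof.
set P := tensS (mulS U U') _ => sU tU; move: s sU.
apply: (@tensS_sub _ _ _ _ ((fun s => s * t) @^-1` P)).
  exact/subspace_preimage/lspan_subspace/mulr_linearr.
move=> a b aU bW /=; move: t tU.
apply: (@tensS_sub _ _ _ _ ( *%R (a ⊗ b) @^-1` P)).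
  exact/subspace_preimage/lspan_subspace/mulr_linearl.
move=> a' b' aU' bW' /=; rewrite tens_mul_pure.
by apply: mem_tensS; exact: mem_mulS.
Qed.

Lemma tmap_bilinear (U V U' V' : lmodType k) (f : U -> U') (g : V -> V') :
  linear f -> linear g -> bilinear_for *:%R *:%R (fun u v => f u ⊗ g v).
Proof.
have [pl pr] := tpure_bilinear U' V'.
move=> fl gl; split=> [v a x y|u a x y] /=.
  by rewrite fl; exact: pl.
by rewrite gl; exact: pr.
Qed.

Lemma tmap_tensS (U V U' V' : lmodType k) (f : U -> U') (g : V -> V')
    A B A' B' : linear f -> linear g ->
  (forall a, A a -> A' (f a)) -> (forall b, B b -> B' (g b)) ->
  forall t, tensS A B t -> tensS A' B' (tmap f g t).
Proof.
move=> fl gl fA gB; apply: tlift_tensS => //; first exact: tmap_bilinear.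
by move=> a b aA bB; apply: mem_tensS; [exact: fA|exact: gB].
Qed.

(** The use is with [f] and [g] both the projection onto H_e: it leaves Δ(x) unchanged when x lies
    in H_e. *)
Lemma tmap_id_tensS (U V : lmodType k) (f : U -> U) (g : V -> V)
    (A : set U) (B : set V) : linear f -> linear g ->
  (forall a, A a -> f a = a) -> (forall b, B b -> g b = b) ->
  forall t, tensS A B t -> tmap f g t = t.
Proof.
move=> fl gl fA gB.
have tl := tlift_linear (tmap_bilinear fl gl).
apply: tensS_sub.
  split=> [|a x y]; first exact: linear_fun0.
  by rewrite /tmap tl => -> ->.
by move=> a b aA bB; rewrite /tmap tliftE ?fA ?gB //; exact: tmap_bilinear.
Qed.

End Tensors.

(** * Strong grading of [H], and the passage of ideals between [H] and H_e *)

Section StronglyGraded.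
Variables (k : fieldType) (G : groupType) (H : algType k) (Q : quasi_hopf H).
Variable gr : G -> set H.
Hypotheses (gr_graded : graded_quasi_hopf Q gr) (gr_faithful : faithful_grading gr).

Lemma gr_subspace g : subspace (gr g).
Proof. by case: gr_graded => -[]. Qed.
#[local] Hint Resolve gr_subspace : core.

Lemma gr_mul g h x y : gr g x -> gr h y -> gr (g * h)%g (x * y).
Proof.
by move=> xg yh; case: gr_graded => _ + _ _ _; apply; exact: mem_mulS.
Qed.

Lemma gr_mul1l g x y : gr 1%g x -> gr g y -> gr g (x * y).
Proof. by move=> x1 yg; rewrite -[g]mul1g; exact: gr_mul. Qed.

Lemma gr_mul1r g x y : gr g x -> gr 1%g y -> gr g (x * y).
Proof. by move=> x1 yg; rewrite -[g]mulg1; exact: gr_mul. Qed.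

Lemma gr_ind P : subspace P -> (forall g x, gr g x -> P x) -> forall x, P x.
Proof.
move=> Ps h x; case: gr_graded => -[_ HE _] _ _ _ _.
by have : [set: H] x by []; rewrite HE; apply: sumS_sub.
Qed.

(** If ε vanished on H_g, then x = x'ε(x'') with Δ(x) in H_g ⊗ H_g would give x = 0 for all x in
    H_g, against faithfulness. *)
Lemma counit_neq0 g : exists2 x, gr g x & qh_counit Q x != 0.
Proof.
apply: contrapT => nx; apply: (gr_faithful (g := g)).
have eps0 x : gr g x -> qh_counit Q x = 0.
  by move=> xg; apply: contrapT => /eqP x0; apply: nx; exists x.
apply/seteqP; split=> [x xg|_ ->]; last exact: subspace0.
rewrite -(qh_counitr Q x).
have xgg : tensS (gr g) (gr g) (qh_comul Q x).
  by case: gr_graded => _ _ + _ _; exact.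
apply: tlift_tensS xgg; [|exact: subspace_set0|].
  split=> [z a u v|y a u v] /=; first by rewrite scalerDr !scalerA mulrC.
  by rewrite linearP scalerDl scalerA.
by move=> y z yg /eps0 /= ->; rewrite scale0r.
Qed.

Lemma strongly_graded g : mulS (gr g^-1%g) (gr g) 1.
Proof.
set P := mulS _ _.
have [_ _ grD grS [Phi1 a1 b1]] := gr_graded.
(* [P] is stable under H_e on both sides, so it is enough to put α into it. *)
have PL x y : gr 1%g x -> P y -> P (x * y).
  by move=> x1; apply: mulS_subl => u; exact: gr_mul1l.
have PR x y : P x -> gr 1%g y -> P (x * y).
  by move=> + y1; apply: mulS_subr => u ug; exact: gr_mul1r.
have Pa : P (qh_alpha Q).
  have [x xg x0] := counit_neq0 g.
  (* Dividing the antipode axiom by ε(x) gives α = ε(x)⁻¹ S(x')αx'', with S(x')α in H_{g⁻¹} and x''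
     in H_g. *)
  rewrite -[qh_alpha Q]scale1r -(mulVf x0) -scalerA -qh_alphaP.
  apply: (@subspaceZ _ _ P) => //.
  apply: tlift_tensS (grD _ _ xg); [|exact: lspan_subspace|].
    split=> [z a u v|y a u v] /=.
      by rewrite linearP !mulrDl !scalerAl.
    by rewrite mulrDr scalerAr.
  move=> y z yg zg; apply: mem_mulS => //.
  by apply: gr_mul1r => //; exact: grS.
have bil x : bilinear_for *:%R *:%R (fun y z : H =>
    x * qh_beta Q * qh_antipode Q y * qh_alpha Q * z).
  split=> [z a u v|y a u v] /=; last by rewrite mulrDr scalerAr.
  by rewrite linearP mulrDr !mulrDl -scalerAr !scalerAl.
rewrite -(qh_zigzag Q); apply: tlift_tensS Phi1; [|exact: lspan_subspace|].
  split=> [t|x]; last exact: tlift_linear.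
  by apply: tlift_param => y z a u v; rewrite !mulrDl !scalerAl.
move=> x t x1; apply: tlift_tensS => // y z y1 z1.
(* In xβS(y)αz the factor α lies in [P]; what remains is that xβS(y) lies in H_e, where S(y) has
   degree e⁻¹ = e. *)
apply: PR => //; apply: PL => //.
apply: gr_mul1l; first exact: gr_mul1l.
by rewrite -invg1; exact: grS.
Qed.

Lemma strongly_gradedV g : mulS (gr g) (gr g^-1%g) 1.
Proof. by have := @strongly_graded g^-1%g; rewrite invgK. Qed.

(** * Homogeneous parts of a two-sided ideal of [H] *)

Section GradedIdeal.
Variable I : set H.
Hypothesis (I_subspace : subspace I)
  (I_ideal : forall a x, I x -> I (a * x) /\ I (x * a)).

Lemma mulS_gr_ideal g : mulS (gr g) (I `&` gr 1%g) = I `&` gr g.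
Proof.
apply/seteqP; split=> [|x [xI xg]].
  apply: mulS_sub; first exact: subspaceI.
  by move=> u w ug [wI w1]; split; [have [] := I_ideal u wI|exact: gr_mul1r].
(* Generalizing 1 to any element of H_gH_{g⁻¹} allows induction on the span. For a product uw one
   has (uw)x = u(wx), with wx in I ∩ H_e. *)
set P := mulS _ _; rewrite -[x]mul1r; move: 1 (@strongly_gradedV g).
apply: (@mulS_sub _ _ _ _ ((fun y => y * x) @^-1` P)).
  exact/subspace_preimage/lspan_subspace/mulr_linearr.
move=> u w ug wg /=; rewrite -mulrA; apply: mem_mulS => //.
by split; [have [] := I_ideal w xI|rewrite -(mulVg g); exact: gr_mul].
Qed.

Lemma mulS_ideal_gr g : mulS (I `&` gr 1%g) (gr g) = I `&` gr g.
Proof.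
apply/seteqP; split=> [|x [xI xg]].
  apply: mulS_sub; first exact: subspaceI.
  by move=> w u [wI w1] ug; split; [have [] := I_ideal u wI|exact: gr_mul1l].
(* Mirror argument with 1 in H_{g⁻¹}H_g: x(uw) = (xu)w, with xu in I ∩ H_e. *)
set P := mulS _ _; rewrite -[x]mulr1; move: 1 (@strongly_graded g).
apply: (@mulS_sub _ _ _ _ ( *%R x @^-1` P)).
  exact/subspace_preimage/lspan_subspace/mulr_linearl.
move=> u w ug wg /=; rewrite mulrA; apply: mem_mulS => //.
by split; [have [] := I_ideal u xI|rewrite -(mulgV g); exact: gr_mul].
Qed.

End GradedIdeal.

Lemma graded_ideal_restrict I : graded_quasi_hopf_ideal Q gr I ->
  invariant_quasi_hopf_ideal Q gr (I `&` gr 1%g).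
Proof.
move=> [[[_ Is] Iid IDelta Ieps IS] [_ IE _]].
have {}Iid a x : I x -> I (a * x) /\ I (x * a) by exact: Iid.
have [grd _ grD grS _] := gr_graded.
(* Invariance holds because both products equal I ∩ H_g. *)
split; last by move=> g; rewrite mulS_gr_ideal // mulS_ideal_gr.
split.
- by split; [exact: subIsetr|exact: subspaceI].
- move=> a x a1 [xI x1]; have [] := Iid a x xI.
  by split; split=> //; exact: gr_mul1l.
- move=> x [xI x1].
  have [p [pl pid p0]] := direct_sum_proj 1%g grd.
  have p1 y : gr 1%g (p y).
    move: y; apply: gr_ind; first exact: subspace_preimage.
    move=> g y; have [-> y1|g1 yg] := eqVneq g 1%g; first by rewrite pid.
    by rewrite (p0 g) //; exact: subspace0.
  (* Here the grading of [I] enters: [I] is spanned by homogeneous elements of [I], each of which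
     [p] fixes or kills. *)
  have pI y : I y -> (I `&` gr 1%g) (p y).
    rewrite {1}IE; move: y; apply: sumS_sub.
      exact/subspace_preimage/subspaceI.
    move=> g y [yI]; have [-> y1|g1 yg] := eqVneq g 1%g; first by rewrite /= pid.
    by rewrite /= (p0 g) //; split; exact: subspace0.
  have [t tI [u uI tu]] := IDelta _ xI.
  (* Since Δ(x) is fixed by p ⊗ p, projecting its two summands in I ⊗ H and H ⊗ I gives summands
     over H_e. *)
  have <- : tmap p p (qh_comul Q x) = qh_comul Q x.
    by apply: tmap_id_tensS (grD _ _ x1).
  have tl := tlift_linear (tmap_bilinear pl pl).
  rewrite -tu /tmap (linear_funD tl).
  exists (tmap p p t); first by apply: tmap_tensS tI.
  by exists (tmap p p u) => //; apply: tmap_tensS uI.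
- by move=> x [/Ieps].
- by move=> x [/IS xI x1]; split=> //; rewrite -invg1; exact: grS.
Qed.

Lemma graded_ideal_restrictK I : graded_quasi_hopf_ideal Q gr I ->
  sumS (fun g => mulS (gr g) (I `&` gr 1%g)) = I.
Proof.
move=> [[[_ Is] Iid _ _ _] [_ IE _]]; rewrite [RHS]IE; congr sumS.
by apply/funext => g; apply: mulS_gr_ideal => // a x; exact: Iid.
Qed.

(** * The ideal J^G induced by a G-invariant quasi-Hopf ideal [J] of H_e *)

Section InvariantIdeal.
Variable J : set H.
Hypothesis J_ideal : invariant_quasi_hopf_ideal Q gr J.

Local Notation JG := (sumS (fun g => mulS (gr g) J)).

Lemma mulS_gr_sub g : mulS (gr g) J `<=` gr g.
Proof.
have [[[J1 _] _ _ _ _] _] := J_ideal.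
by apply: mulS_sub => // u w ug /J1 w1; exact: gr_mul1r.
Qed.

Lemma mulS_gr1_sub : mulS (gr 1%g) J `<=` J.
Proof.
have [[[_ Js] Jid _ _ _] _] := J_ideal.
by apply: mulS_sub => // u w u1 wJ; have [] := Jid u w u1 wJ.
Qed.

Lemma sumS_restrict : JG `&` gr 1%g = J.
Proof.
have [grd _ _ _ _] := gr_graded.
have [[[J1 Js] Jid _ _ _] _] := J_ideal.
apply/seteqP; split=> [x [xJ x1]|x xJ]; last first.
  split; last exact: J1.
  apply: (@sub_sumS _ _ _ _ 1%g).
  rewrite -[x]mul1r.
  (* The unit lies in H_e by strong grading at e, since H_eH_e is contained in H_e; so x = 1x lies
     in the summand H_eJ. *)
  apply: mem_mulS => //; have := @strongly_graded 1%g.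
  by apply: mulS_sub => // u w; rewrite invg1; exact: gr_mul1l.
have [p [pl pid p0]] := direct_sum_proj 1%g grd.
(* Replacing x by [p x] makes the claim linear on all of J^G: [p] kills H_gJ for g other than e and
   fixes H_eJ, which lies in [J]. *)
rewrite -(pid _ x1); move: x xJ {x1}; apply: sumS_sub.
  exact: subspace_preimage.
move=> g x xJ; have xg := mulS_gr_sub xJ; move: xJ xg.
have [-> xJ x1|g1 _ xg] := eqVneq g 1%g.
  by rewrite /= pid //; exact: mulS_gr1_sub.
by rewrite /= (p0 g) //; exact: subspace0.
Qed.

Lemma sumS_ideal a x : JG x -> JG (a * x) /\ JG (x * a).
Proof.
have [_ Jinv] := J_ideal.
move=> xJ; split; move: a; apply: gr_ind.
- exact/subspace_preimage/lspan_subspace/mulr_linearr.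
- move=> g a ag; move: x xJ; apply: sumS_sub.
    exact/subspace_preimage/lspan_subspace/mulr_linearl.
  move=> h x xJ; apply: (@sub_sumS _ _ _ _ (g * h)%g).
  by apply: mulS_subl xJ => u; exact: gr_mul.
- exact/subspace_preimage/lspan_subspace/mulr_linearl.
- move=> g a ag; move: x xJ; apply: sumS_sub.
    exact/subspace_preimage/lspan_subspace/mulr_linearr.
  (* Invariance puts H_hJ in the form JH_h, so that a right factor from H_g meets H_h and lands in
     JH_{hg} = H_{hg}J. *)
  move=> h x; rewrite Jinv => xJ; apply: (@sub_sumS _ _ _ _ (h * g)%g).
  by rewrite Jinv; apply: mulS_subr xJ => u uh; exact: gr_mul.
Qed.

Lemma sumS_graded_ideal : graded_quasi_hopf_ideal Q gr JG.
Proof.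
have [[grs _ gri] _ grD grS _] := gr_graded.
have [[[J1 Js] Jid JDelta Jeps JS] Jinv] := J_ideal.
split.
  split; [by []|by move=> a x _; exact: sumS_ideal|..].
  - apply: sumS_sub => [|g].
      by apply: subspace_preimage; [exact: linearP|exact: subspace_addS].
    apply: mulS_sub => [|u w ug wJ] /=.
      by apply: subspace_preimage; [exact: linearP|exact: subspace_addS].
    have [t tJ [t' tJ' tt']] := JDelta _ wJ.
    have uD := grD _ _ ug.
    have sub : mulS (gr g) J `<=` JG by exact: (@sub_sumS _ _ _ _ g).
    (* Multiplying by Δ(u) in H_g ⊗ H_g carries J ⊗ H_e into H_gJ ⊗ H and H_e ⊗ J into H ⊗ H_gJ. *)
    rewrite rmorphM /= -tt' mulrDr.
    exists (qh_comul Q u * t).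
      by apply: tensSS (tensM_tensS uD tJ).
    by exists (qh_comul Q u * t') => //; apply: tensSS (tensM_tensS uD tJ').
  - apply: (@sumS_sub _ _ _ _ [set x | qh_counit Q x = 0]) => [|g].
      split=> [|a x y /= x0 y0]; first exact: linear0.
      by rewrite linearP /= x0 y0 scaler0 addr0.
    apply: mulS_sub => [|u w ug wJ] /=.
      split=> [|a x y /= x0 y0]; first exact: linear0.
      by rewrite linearP /= x0 y0 scaler0 addr0.
    by rewrite rmorphM /= (Jeps w wJ) mulr0.
  - apply: sumS_sub => [|g].
      by apply: subspace_preimage; [exact: linearP|exact: lspan_subspace].
    apply: mulS_sub => [|u w ug wJ] /=.
      by apply: subspace_preimage; [exact: linearP|exact: lspan_subspace].
    (* S reverses products, so S(uw) falls in JH_{g⁻¹}, which invariance turns into H_{g⁻¹}J. *)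
    rewrite qh_antipodeM; apply: (@sub_sumS _ _ _ _ g^-1%g).
    by rewrite Jinv; apply: mem_mulS; [exact: JS|exact: grS].
split.
- by move=> g; apply: subspaceI.
- apply/seteqP; split; apply: sumS_sub => // g x.
    move=> xJ; apply: (@sub_sumS _ _ _ _ g).
    by split; [exact: (@sub_sumS _ _ _ _ g)|exact: mulS_gr_sub].
- by apply: independent_sub gri => g x [].
Qed.

End InvariantIdeal.
End StronglyGraded.

Theorem corollary7p1 (k : fieldType) (G : groupType) (H : algType k)
    (Q : quasi_hopf H) (gr : G -> set H)
    (gr_graded : graded_quasi_hopf Q gr) (gr_faithful : faithful_grading gr) :
  [/\ set_bij [set I | graded_quasi_hopf_ideal Q gr I]
              [set J | invariant_quasi_hopf_ideal Q gr J]
              (fun I : set H => I `&` gr 1%g),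
      set_bij [set J | invariant_quasi_hopf_ideal Q gr J]
              [set I | graded_quasi_hopf_ideal Q gr I]
              (fun J : set H => sumS (fun g => mulS (gr g) J)),
      forall I, graded_quasi_hopf_ideal Q gr I ->
        sumS (fun g => mulS (gr g) (I `&` gr 1%g)) = I &
      forall J, invariant_quasi_hopf_ideal Q gr J ->
        sumS (fun g => mulS (gr g) J) `&` gr 1%g = J].
Proof.
have restr := graded_ideal_restrict gr_graded gr_faithful.
have restrK := graded_ideal_restrictK gr_graded gr_faithful.
have ind J := @sumS_graded_ideal _ _ _ _ _ gr_graded J.
have indK J := @sumS_restrict _ _ _ _ _ gr_graded gr_faithful J.
(* For each map, one composite identity gives injectivity and the other supplies the preimages for
   surjectivity. *)
split=> //; split.
- by move=> I /restr.
- by move=> I I' /set_mem/restrK + /set_mem/restrK + E; rewrite E => -> ->.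
- by move=> J Jinv; eexists; [exact: ind Jinv|exact: indK].
- by move=> J /ind.
- by move=> J J' /set_mem/indK + /set_mem/indK + E; rewrite E => -> ->.
- by move=> I Igr; eexists; [exact: restr Igr|exact: restrK].
Qed.
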